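(* Let $G=(V,E)$ be a connected, locally finite graph whose vertex isoperimetric constant $$\mathbf{i}_V(G):=\inf\left\{\frac{|\partial_V K|}{|K|}: K\subset V \text{ finite, nonempty}\right\}$$ is strictly positive. Then in i.i.d. Bernoulli site percolation on $G$, there is uniform percolation at every level $p\in\left(\frac{1}{\mathbf{i}_V(G)+1},1\right)$.
   Context: For $K\subset V$, $\partial_V K$ is the set of vertices not in $K$ that are adjacent to some vertex of $K$. In i.i.d. Bernoulli($p$) site percolation each vertex is independently open (state 1) with probability $p$; a 1-cluster is a maximal connected set of open vertices. There is uniform percolation at level $p$ if $\lim_{N\to\infty}\inf_{x\in V}\mathbb{P}_p(B(x,N)\text{ intersects an infinite 1-cluster})=1$, where $B(x,N)$ is the ball of radius $N$ about $x$ in the graph metric. *)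

(* Defs.v *)
From HB Require Import structures.
From mathcomp Require Import all_boot all_order all_algebra finmap.
From mathcomp Require Import all_classical all_reals all_analysis.

Set Implicit Arguments.
Unset Strict Implicit.
Unset Printing Implicit Defensive.
Import Order.TTheory GRing.Theory Num.Theory.
Import numFieldNormedType.Exports.
Local Open Scope classical_set_scope.
Local Open Scope ring_scope.

Section Graph.
Context {V : choiceType} (e : rel V).

Definition locally_finite := forall x, finite_set [set y | e x y].

Definition vertex_boundary (K : set V) : set V :=
  [set y | ~ K y /\ exists2 x, K x & e x y].

(* Connectedness of the subgraph induced by [C]; the empty set is excluded. *)
Definition connected_set (C : set V) :=
  C !=set0 /\
  forall x y, C x -> C y ->
    exists s, [/\ path e x s, last x s = y & [set` s] `<=` C].

Definition connected_graph := connected_set [set: V].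

Definition walk (n : nat) (x y : V) :=
  exists s, [/\ path e x s, last x s = y & size s = n].

(* Equal to 0 by convention when [x] and [y] lie in different components, which
   does not occur in a connected graph. *)
Definition graph_dist (x y : V) : nat :=
  xget 0%N [set n | walk n x y /\ forall m, walk m x y -> (n <= m)%N].

Definition graph_ball (x : V) (N : nat) : set V :=
  [set y | (graph_dist x y <= N)%N].

Definition open_cluster (O C : set V) :=
  [/\ C `<=` O, connected_set C &
      forall D, D `<=` O -> connected_set D -> C `<=` D -> D = C].

(* The cardinality of the boundary is that of [fset_set], which is meaningful
   because the boundary of a finite set is finite in a locally finite graph. *)
Definition vertex_isoperimetric {R : realType} : R :=
  inf [set #|` fset_set (vertex_boundary [set` K])|%:R / #|` K|%:R
      | K in [set K : {fset V} | K != fset0]].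

End Graph.

Section Percolation.
Context {R : realType} {d : measure_display} {Omega : measurableType d}.
Context (P : probability Omega R) {V : choiceType}.

Definition independent_RVs {d'} {T : measurableType d'}
    (X : V -> {RV P >-> T}) :=
  forall (J : {fset V}) (A : V -> set T),
    (forall v, v \in J -> measurable (A v)) ->
    P (\bigcap_(v in [set` J]) (X v @^-1` A v)) =
    (\prod_(v <- J) P (X v @^-1` A v))%E.

(* Any realization of the Bernoulli([p]) product measure on {0,1}^V: the state
   of [v] in the configuration indexed by [w] is [X v w], and [true] is open. *)
Definition bernoulli_site_percolation (p : R) (X : V -> {RV P >-> bool}) :=
  (forall v, distribution P (X v) =1 bernoulli_prob p) /\ independent_RVs X.

Definition open_sites (X : V -> {RV P >-> bool}) (w : Omega) : set V :=
  [set v | X v w].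

Definition ball_meets_infinite_cluster (e : rel V) (X : V -> {RV P >-> bool})
    (x : V) (N : nat) : set Omega :=
  [set w | exists C, [/\ open_cluster e (open_sites X w) C, infinite_set C &
                         graph_ball e x N `&` C !=set0]].

Definition uniform_percolation (e : rel V) (X : V -> {RV P >-> bool}) :=
  (fun N => ereal_inf (range
     (fun x => P (ball_meets_infinite_cluster e X x N)))) @ \oo --> 1%E.

End Percolation.

(* Main.v *)
(* Let [B] be the ball of radius [N] about [x], [i] the isoperimetric constant
   and [q = 1 / (i + 1)]. If no infinite cluster meets the ball of radius
   [N + 1], then, once the vertices of [B] are declared open, the cluster [K] of
   [B] is finite, [K \ B] is open and the boundary of [K] is closed. For a given
   [K] this has probability [p ^ a * (1 - p) ^ b] with [a = |K \ B|] and
   [b = |bd K| >= i * (a + |B|)]. Since [t * (1 - t) ^ i] is maximal at [t = q],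
   replacing [p] by [q] gains a factor [exp (- c |B|)] with [c = p / q - 1 > 0],
   and the [q]-weights of all possible [K] sum to at most [1] because the
   corresponding cylinders are pairwise disjoint. As [|B| > N], the probability
   that no infinite cluster meets the larger ball is at most [exp (- c N)],
   uniformly in [x]. *)
Require Import Defs.
From HB Require Import structures.
From mathcomp Require Import all_boot all_order all_algebra finmap.
From mathcomp Require Import all_classical all_reals all_analysis.
From mathcomp Require Import ring lra.
Import Order.TTheory GRing.Theory Num.Theory.
Import numFieldNormedType.Exports.
Set Implicit Arguments.
Unset Strict Implicit.
Unset Printing Implicit Defensive.
Local Open Scope classical_set_scope.
Local Open Scope ring_scope.

(** * Kraft inequality for incompatible cylinders, and the change of weight from [p] to [q] *)

(** Read [A i] as the sites that [i] requires open and [B i] as those it requires closed: pairwise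
    disjoint cylinders have total mass at most 1. Revealing the sites of [W] one by one proves this
    by algebra alone, without a measure at level [q]. *)
Lemma kraft_count (R : realDomainType) (V : eqType) (I : eqType) (q : R)
    (A B : I -> pred V) (W : seq V) (r : seq I) :
  0 <= q <= 1 -> uniq r ->
  (forall i v, i \in r -> ~~ (A i v && B i v)) ->
  {in r &, forall i j, i != j ->
    has (fun v => A i v && B j v || B i v && A j v) W} ->
  \sum_(i <- r) q ^+ count (A i) W * (1 - q) ^+ count (B i) W <= 1.
Proof.
move=> /andP[q0 q1]; elim: W r => [|v W IH] r ur dAB inc.
  (* With no site left, two distinct indices have nowhere to conflict, so [r] has at most one
     element. *)
  case: r ur dAB inc => [|i [|j r]] ur _ inc; rewrite ?big_nil ?ler01//.
    by rewrite big_seq1 /= mulr1.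
  have ij : i != j by move: ur; rewrite /= inE negb_or => /andP[/andP[]].
  by have := inc i j _ _ ij; rewrite !inE !eqxx ?orbT => /(_ isT isT).
pose f i := q ^+ count (A i) W * (1 - q) ^+ count (B i) W.
(* Indices that do not conflict at [v] still conflict pairwise in the tail, so the induction
   hypothesis applies to them. *)
have sub (Q : pred I) : (forall i j, i \in r -> j \in r -> Q i -> Q j ->
    ~~ (A i v && B j v || B i v && A j v)) -> \sum_(i <- r | Q i) f i <= 1.
  move=> Qr; rewrite -big_filter; apply: IH.
  - exact: filter_uniq.
  - by move=> i u; rewrite mem_filter => /andP[_ ir]; exact: dAB.
  move=> i j; rewrite !mem_filter => /andP[Qi ir] /andP[Qj jr] ij.
  by have := inc i j ir jr ij; rewrite /= (negbTE (Qr _ _ ir jr Qi Qj)).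
(* Condition on the state of [v]: an index with no demand at [v] enters both sums, with coefficients
   adding up to 1. *)
have splitE i : i \in r ->
    q ^+ count (A i) (v :: W) * (1 - q) ^+ count (B i) (v :: W) =
    q * (if ~~ B i v then f i else 0) + (1 - q) * (if ~~ A i v then f i else 0).
  move=> ir; have := dAB i v ir; rewrite /f /=.
  by case: (A i v); case: (B i v) => //= _; rewrite ?add1n ?add0n ?exprS; ring.
rewrite big_seq (eq_bigr _ splitE) -big_seq big_split /= -!mulr_sumr.
rewrite -!big_mkcond /=.
have s1 : \sum_(i <- r | ~~ B i v) f i <= 1.
  by apply: sub => i j _ _ /negbTE-> /negbTE->; rewrite andbF.
have s2 : \sum_(i <- r | ~~ A i v) f i <= 1.
  by apply: sub => i j _ _ /negbTE-> /negbTE->; rewrite andbF.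
have := ler_wpM2l q0 s1.
have : (1 - q) * \sum_(i <- r | ~~ A i v) f i <= (1 - q) * 1.
  by apply: ler_wpM2l => //; rewrite subr_ge0.
by lra.
Qed.

Lemma count_mem_fset (V : choiceType) (A W : {fset V}) :
  (A `<=` W)%fset -> count (mem A) W = #|` A|.
Proof.
move=> AW; rewrite -size_filter -(size_map id); apply/perm_size/uniq_perm.
- by rewrite map_id filter_uniq ?fset_uniq.
- exact: fset_uniq.
move=> x; rewrite map_id mem_filter /=; case: (boolP (x \in A)) => //= xA.
by rewrite (fsubsetP AW).
Qed.

Lemma kraft_fset (R : realDomainType) (V I : choiceType) (q : R)
    (A B : I -> {fset V}) (r : {fset I}) :
  0 <= q <= 1 ->
  (forall i, i \in r -> [disjoint A i & B i]%fset) ->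
  {in r &, forall i j, i != j ->
    exists v, (v \in A i) && (v \in B j) || (v \in B i) && (v \in A j)} ->
  \sum_(i <- r) q ^+ #|` A i| * (1 - q) ^+ #|` B i| <= 1.
Proof.
move=> q01 dAB inc; pose W := (\bigcup_(i <- r) (A i `|` B i))%fset.
have AW i : i \in r -> (A i `<=` W)%fset.
  by move=> ir; apply: fsubset_trans (bigfcup_sup _ ir isT); exact: fsubsetUl.
have BW i : i \in r -> (B i `<=` W)%fset.
  by move=> ir; apply: fsubset_trans (bigfcup_sup _ ir isT); exact: fsubsetUr.
rewrite big_seq (eq_bigr (fun i => q ^+ count (mem (A i)) W *
    (1 - q) ^+ count (mem (B i)) W)); last first.
  by move=> i ir; rewrite !count_mem_fset ?AW ?BW.
rewrite -big_seq; apply: kraft_count => //.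
  by move=> i v ir; apply/negP => /andP[/(fdisjointP (dAB i ir))/negP].
move=> i j ir jr ij; have [v vij] := inc i j ir jr ij.
apply/hasP; exists v => //.
by case/orP: vij => /andP[vi vj];
  [exact: (fsubsetP (AW i ir)) | exact: (fsubsetP (BW i ir))].
Qed.

(** With [c = p / q - 1], one has [p = q (1 + c)] and [1 - p = (1 - q) (1 - c / i)]. Bounding both
    by [1 + x <= expR x] leaves the exponent [c (a - b / i)], which is at most [- c n] by the
    hypothesis on [b]. *)
Lemma bernoulli_weight_tilt (R : realType) (i p q : R) (a b n : nat) :
  0 < i -> q = (i + 1)^-1 -> q < p < 1 -> i * (a + n)%:R <= b%:R ->
  p ^+ a * (1 - p) ^+ b <=
    expR (- (p / q - 1)) ^+ n * (q ^+ a * (1 - q) ^+ b).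
Proof.
move=> i0 qi /andP[qp p1] ib.
have i1 : 0 < i + 1 by lra.
have q0 : 0 < q by rewrite qi invr_gt0.
have qE : 1 - q = i * q by rewrite qi; field; lra.
have iq : 0 < i * q by rewrite mulr_gt0.
pose c := p / q - 1.
have c0 : 0 <= c by rewrite subr_ge0 ler_pdivlMr ?mul1r // ltW.
have hp : p <= q * expR c.
  rewrite mulrC -ler_pdivrMr //; apply: le_trans (expR_ge1Dx c).
  by rewrite /c; lra.
have hp' : 1 - p <= (1 - q) * expR (- (c / i)).
  rewrite qE mulrC -ler_pdivrMr //.
  have -> : (1 - p) / (i * q) = 1 - c / i by rewrite /c qi; field; lra.
  exact: expR_ge1Dx.
have h1 : p ^+ a <= (q * expR c) ^+ a.
  by apply: lerXn2r; rewrite ?nnegrE //; lra.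
have h2 : (1 - p) ^+ b <= ((1 - q) * expR (- (c / i))) ^+ b.
  by apply: lerXn2r; rewrite ?nnegrE //; lra.
apply: le_trans (ler_pM _ _ h1 h2) _; rewrite ?exprn_ge0 //; try lra.
rewrite !exprMn mulrACA mulrC ler_wpM2r ?mulr_ge0 ?exprn_ge0 ?qE //; try lra.
rewrite -!expRM_natl -expRD ler_expR -/c.
rewrite -(ler_pM2l i0).
have -> : i * (a%:R * c + b%:R * - (c / i)) = c * (i * a%:R - b%:R).
  by field; lra.
have -> : i * (n%:R * - c) = c * (- (i * n%:R)) by ring.
by apply: ler_wpM2l => //; move: ib; rewrite natrD; lra.
Qed.

(** * Exploration of open clusters from a set of vertices *)

Section Reach.
Context {V : choiceType} (e : rel V).
Implicit Types A O K M : set V.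

(** For symmetric [e] this is the union of the clusters of [O] that meet [A]. A set [K] is contained
    in [reach B K] when each of its vertices is joined to [B] inside [K]. *)
Inductive reach A O : V -> Prop :=
| reach_start x : A x -> O x -> reach A O x
| reach_step x y : reach A O x -> e x y -> O y -> reach A O y.

Lemma reach_sub A O : reach A O `<=` O.
Proof. by move=> x []. Qed.

Lemma reach_min A O K : A `&` O `<=` K ->
  (forall x y, K x -> e x y -> O y -> K y) -> reach A O `<=` K.
Proof.
move=> AK stK x; elim=> {x}[x Ax Ox|x y _ Kx xy Oy]; first exact: AK.
exact: stK Kx xy Oy.
Qed.

Lemma reach_path A O x s :
  reach A O x -> path e x s -> [set` s] `<=` O -> reach A O (last x s).
Proof.
elim: s x => //= y s IH x rx /andP[xy ys] sO; apply: IH => //.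
- by apply: reach_step rx xy _; apply: sO; rewrite /= inE eqxx.
- by move=> z zs; apply: sO; rewrite /= inE [z \in s]zs orbT.
Qed.

Lemma reach_bigcup A O : reach A O = \bigcup_(y in A) reach [set y] O.
Proof.
apply/seteqP; split.
  apply: reach_min => [x [Ax Ox]|x y [z Az rx] xy Oy].
    by exists x => //; exact: reach_start.
  by exists z => //; exact: reach_step rx xy Oy.
move=> x [y Ay]; apply: reach_min => {}x.
  by move=> [-> Oy]; exact: reach_start.
by move=> z; exact: reach_step.
Qed.

Lemma connected_set_sub_reach A O C :
  C `<=` O -> connected_set e C -> A `&` C !=set0 -> C `<=` reach A O.
Proof.
move=> CO [_ cC] [y [Ay Cy]] z Cz; have [s [ys <- sC]] := cC y z Cy Cz.
apply: reach_path ys (subset_trans sC CO).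
by apply: reach_start => //; exact: CO.
Qed.

Lemma reach_open_cluster O y :
  symmetric e -> O y -> open_cluster e O (reach [set y] O).
Proof.
move=> sym Oy; have ry : reach [set y] O y by exact: reach_start.
split; first exact: reach_sub; last first.
  move=> D DO cD rD; apply/seteqP; split => //.
  by apply: connected_set_sub_reach DO cD _; exists y; split=> //; exact: rD.
split; first by exists y.
have to_y x : reach [set y] O x ->
    exists s, [/\ path e x s, last x s = y & [set` s] `<=` reach [set y] O].
  elim=> {x}[x -> _|x z rx [s [xs sy sr]] xz _]; first by exists [::].
  exists (x :: s); rewrite /= sym xz; split => // u /=.
  by rewrite inE => /predU1P[->//|]; exact: sr.
have of_y x : reach [set y] O x ->
    exists s, [/\ path e y s, last y s = x & [set` s] `<=` reach [set y] O].
  elim=> {x}[x -> _|x z rx [s [ys sx sr]] xz Oz]; first by exists [::].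
  exists (rcons s z); rewrite rcons_path last_rcons sx ys xz; split => // u /=.
  rewrite mem_rcons inE => /predU1P[->|]; last exact: sr.
  exact: reach_step rx xz Oz.
move=> x z /to_y[s [xs sy sr]] /of_y[t [yt tz tr]].
exists (s ++ t); rewrite cat_path last_cat sy xs yt tz; split => // u /=.
by rewrite mem_cat => /orP[/sr|/tr].
Qed.

(** The exploration is a union of clusters indexed by the open vertices of [A], and a finite union
    of finite clusters is finite. *)
Lemma infinite_reachP A O : symmetric e -> finite_set A ->
  (exists C, [/\ open_cluster e O C, infinite_set C & A `&` C !=set0]) <->
  infinite_set (reach A O).
Proof.
move=> sym fA; split=> [[C [[CO cC _] iC AC]]|ir].
  exact: sub_infinite_set (connected_set_sub_reach CO cC AC) iC.
apply: contrapT => nC; apply: ir; rewrite reach_bigcup.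
apply: bigcup_finite => // y Ay; apply: contrapT => iy; apply: nC.
have [z rz] := infinite_setN0 iy.
have Oy : O y by elim: rz => [x -> |].
exists (reach [set y] O); split => //; first exact: reach_open_cluster.
by exists y; split => //; exact: reach_start.
Qed.

(** The set [K] is a certificate that involves closed vertices only: they trap the exploration
    inside [K]. For finite [M] there are finitely many certificates, which yields measurability. *)
Lemma reach_subP A O M :
  reach A O `<=` M <->
  exists2 K, K `<=` M & (A `\` K) `|` vertex_boundary e K `<=` ~` O.
Proof.
split=> [rM|[K KM hK]].
  exists (reach A O) => // x [[Ax nr]|[nr [y ry yx]]] Ox; apply: nr.
    exact: reach_start.
  exact: reach_step ry yx Ox.
apply: subset_trans KM; apply: reach_min => [x [Ax Ox]|x y Kx xy Oy].
  by apply: contrapT => nK; apply: hK Ox; left.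
by apply: contrapT => nK; apply: hK Oy; right; split => //; exists x.
Qed.

(** After its last exit from [B], a path continues from an open vertex of the boundary of [B], hence
    from an open vertex of [A]. This is why the radius grows from [N] to [N + 1]. *)
Lemma reach_setU_sub B A O M :
  B `<=` A -> vertex_boundary e B `<=` A -> B `<=` M ->
  reach A O `<=` M -> reach B (O `|` B) `<=` M.
Proof.
move=> BA dBA BM rM.
suff h : reach B (O `|` B) `<=` B `|` reach A O by move=> x /h[/BM//|/rM].
apply: reach_min => [x [Bx _]|x y hx xy]; first by left.
have [By _|nBy [Oy|//]] := pselect (B y); first by left.
right; case: hx => [Bx|rx]; last exact: reach_step rx xy Oy.
by apply: reach_start => //; apply: dBA; split => //; exists x.
Qed.

Lemma reach_setU_explored B O (K := reach B (O `|` B)) :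
  [/\ B `<=` K, K `<=` reach B K, K `\` B `<=` O &
      vertex_boundary e K `<=` ~` O].
Proof.
split.
- by move=> x Bx; apply: reach_start => //; right.
- move=> x; elim=> {x}[x Bx h|x y rx IH xy h].
    by apply: reach_start => //; exact: reach_start.
  by apply: (reach_step IH xy); exact: reach_step rx xy h.
- by move=> x [/reach_sub[]].
- move=> x [nr [y ry yx]] Ox; apply: nr; apply: reach_step ry yx _; by left.
Qed.

(** When [K] is grown from [B] inside itself, the first vertex outside [K'] would lie in [K] minus
    [B] and on the boundary of [K']. *)
Lemma explored_incompatible B K K' :
  B `<=` K' -> K `<=` reach B K ->
  (forall v, ~ ((K `\` B) v /\ vertex_boundary e K' v)) -> K `<=` K'.
Proof.
move=> BK' rK h; apply: subset_trans rK _.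
apply: reach_min => [x [/BK']//|x y K'x xy Ky].
apply: contrapT => nK'; apply: (h y); split; first by split => // /BK'.
by split => //; exists x.
Qed.

End Reach.

(** * Balls in the graph metric: finiteness, exhaustion and growth *)

Section Balls.
Context {V : choiceType} (e : rel V).
Hypotheses (con : connected_graph e) (lf : locally_finite e).

Lemma finite_vertex_boundary (K : set V) :
  finite_set K -> finite_set (vertex_boundary e K).
Proof.
move=> fK; apply: (@sub_finite_set _ _ (\bigcup_(x in K) [set y | e x y])).
  by move=> y [_ [x Kx xy]]; exists x.
by apply: bigcup_finite => // x _; exact: lf.
Qed.

Lemma graph_distP x y :
  walk e (graph_dist e x y) x y /\
  forall m, walk e m x y -> (graph_dist e x y <= m)%N.
Proof.
apply: (@xgetPex _ 0%N
  [set n | walk e n x y /\ forall m, walk e m x y -> (n <= m)%N]).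
(* Connectedness provides a walk, so a shortest length exists and [xget] does not fall back on its
   default value. *)
have ex : exists n, `[< walk e n x y >].
  have [_ /(_ x y Logic.I Logic.I)[s [xs sy _]]] := con.
  by exists (size s); apply/asboolP; exists s.
case: (ex_minnP ex) => n /asboolP wn min_n; exists n; split => // m wm.
by apply: min_n; apply/asboolP.
Qed.

Lemma graph_ballP x N y :
  graph_ball e x N y <-> exists2 n, (n <= N)%N & walk e n x y.
Proof.
split=> [h|[n nN w]].
  by exists (graph_dist e x y) => //; case: (graph_distP x y).
by apply: leq_trans nN; case: (graph_distP x y) => _; exact.
Qed.

Lemma graph_ball0 x : graph_ball e x 0 = [set x].
Proof.
apply/seteqP; split=> y.
  move=> /graph_ballP[n]; rewrite leqn0 => /eqP-> [s [_ <- /eqP]].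
  by rewrite size_eq0 => /eqP->.
by move=> ->; apply/graph_ballP; exists 0%N => //; exists [::].
Qed.

Lemma graph_ballS x N :
  graph_ball e x N.+1 =
  graph_ball e x N `|` vertex_boundary e (graph_ball e x N).
Proof.
apply/seteqP; split=> y.
  have [yN|yN] := pselect (graph_ball e x N y); first by left.
  move=> /graph_ballP[n nN [s]]; case/lastP: s => [|s z] [xs sy sn].
    by case: yN; apply/graph_ballP; exists 0%N => //; exists [::].
  move: xs sy sn; rewrite rcons_path last_rcons size_rcons.
  move=> /andP[xs sz] zy sn; subst z; right; split => //.
  exists (last x s) => //; apply/graph_ballP; exists (size s); last by exists s.
  by rewrite -ltnS sn.
case=> [h|[_ [z /graph_ballP[n nN [s [xs sz sn]]] zy]]].
  exact: leq_trans h _.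
apply/graph_ballP; exists n.+1 => //; exists (rcons s y).
by rewrite rcons_path last_rcons size_rcons xs sz zy sn.
Qed.

Lemma finite_graph_ball x N : finite_set (graph_ball e x N).
Proof.
elim: N => [|N IH]; first by rewrite graph_ball0; exact: finite_set1.
by rewrite graph_ballS finite_setU; split => //; exact: finite_vertex_boundary.
Qed.

Lemma sub_graph_ball x : {homo graph_ball e x : n m / (n <= m)%N >-> n `<=` m}.
Proof. by move=> n m nm y yn; exact: leq_trans yn nm. Qed.

(** Balls exhaust the graph; this turns finiteness of an exploration into a countable increasing
    union of events. *)
Lemma finite_setP_graph_ball x (A : set V) :
  finite_set A <-> exists m, A `<=` graph_ball e x m.
Proof.
split=> [fA|[m Am]]; last exact: sub_finite_set Am (finite_graph_ball x m).
exists (\max_(y <- fset_set A) graph_dist e x y)%N => y Ay.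
by apply: leq_bigmax_seq => //; rewrite in_fset_set // inE.
Qed.

Context {R : realType}.

Lemma isoperimetric_le (K : {fset V}) : K != fset0 ->
  vertex_isoperimetric e * #|` K|%:R <=
    #|` fset_set (vertex_boundary e [set` K])|%:R :> R.
Proof.
move=> K0; have cK : 0 < #|` K|%:R :> R by rewrite ltr0n cardfs_gt0.
rewrite -ler_pdivlMr //; apply: ge_inf; last by exists K.
by exists 0 => _ [L _ <-]; rewrite divr_ge0.
Qed.

(** A positive isoperimetric constant gives every nonempty finite set a nonempty boundary, so each
    unit of radius adds a vertex. *)
Lemma ltn_card_graph_ball x N : 0 < vertex_isoperimetric e :> R ->
  (N < #|` fset_set (graph_ball e x N)|)%N.
Proof.
move=> i0; elim: N => [|N IH].
  by rewrite graph_ball0 fset_set1 cardfs1.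
have fB := finite_graph_ball x N; set B := graph_ball e x N in IH fB *.
have fd := finite_vertex_boundary fB.
rewrite graph_ballS fset_setU // -/B.
apply: (leq_ltn_trans IH); apply: fproper_ltn_card.
rewrite fproperEneq fsubsetUl andbT.
have B0 : fset_set B != fset0.
  by rewrite -cardfs_gt0; exact: leq_ltn_trans (leq0n _) IH.
have := isoperimetric_le B0; rewrite fset_setK // => hB.
have : 0 < #|` fset_set (vertex_boundary e B)|%:R :> R.
  by apply: lt_le_trans hB; rewrite mulr_gt0 // ltr0n cardfs_gt0.
rewrite ltr0n cardfs_gt0 => /fset0Pn[v]; rewrite in_fset_set // inE => dv.
apply/eqP => /fsetP/(_ v); rewrite in_fsetU !in_fset_set // (mem_set dv) orbT.
by move=> /set_mem; case: dv.
Qed.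
End Balls.

(** * Cylinder events and the exponential bound for a trapped exploration *)

Section Events.
Context {R : realType} {d : measure_display} {Omega : measurableType d}.
Context (P : probability Omega R) {V : choiceType}.
Context (e : rel V) (p : R) (X : V -> {RV P >-> bool}).
Hypotheses (lf : locally_finite e) (p01 : 0 <= p <= 1).
Hypothesis bern : bernoulli_site_percolation p X.

Let bd (K : {fset V}) : {fset V} := fset_set (vertex_boundary e [set` K]).

Let in_bd K v : (v \in bd K) = (v \in vertex_boundary e [set` K]).
Proof. by rewrite in_fset_set //; apply: finite_vertex_boundary. Qed.

Definition cylinder (A F : {fset V}) : set Omega :=
  [set w | [set` A] `<=` open_sites X w /\ [set` F] `<=` ~` open_sites X w].

Lemma measurable_cylinder A F : measurable (cylinder A F).
Proof.
have -> : cylinder A F = (\bigcap_(v in [set` A]) X v @^-1` [set true]) `&`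
                         (\bigcap_(v in [set` F]) X v @^-1` [set false]).
  apply/seteqP; split=> w [hA hF]; split=> v vAF; [exact: hA|..].
  - by apply/negbTE/negP; exact: hF.
  - exact: hA.
  - by apply/negP; rewrite (hF v).
by apply: measurableI; apply: fin_bigcap_measurable => // v _;
  exact: measurable_funPTI.
Qed.

Lemma probability_cylinder (A F : {fset V}) : [disjoint A & F]%fset ->
  P (cylinder A F) = (p ^+ #|` A| * (1 - p) ^+ #|` F|)%:E.
Proof.
move=> dAF; have [dist ind] := bern.
pose S v := if v \in A then [set true] else [set false].
have nA v : v \in F -> (v \in A) = false.
  by move=> vF; apply/negP => /(fdisjointP dAF); rewrite vF.
have -> : cylinder A F = \bigcap_(v in [set` (A `|` F)%fset]) (X v @^-1` S v).
  apply/seteqP; split=> w.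
    move=> [hA hF] v; rewrite /S /= in_fsetU.
    case: ifPn => [vA _|_ /= vF]; first exact: hA.
    by apply/negbTE/negP; exact: hF.
  move=> h; split=> v /= v_in; have := h v; rewrite /S /= in_fsetU v_in.
    by move=> /(_ isT).
  by rewrite orbT nA // => /(_ isT) /= /negbT/negP.
rewrite ind; last by [].
have PS v : P (X v @^-1` S v) = (if v \in A then p else 1 - p)%:E.
  have := dist v (S v); rewrite /distribution /pushforward => ->.
  rewrite bernoulli_probE // !diracE /S.
  case: ifP => _; rewrite !in_set1 /= /unstable.onem.
    by rewrite mule1 mule0 adde0.
  by rewrite mule1 mule0 add0e.
rewrite (eq_bigr _ (fun v _ => PS v)) prodEFin; congr EFin.
rewrite (perm_big (A ++ F)); last first.
  apply: uniq_perm; rewrite ?fset_uniq //.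
    rewrite cat_uniq !fset_uniq /= andbT; apply/hasPn => v vF.
    by rewrite /= nA.
  by move=> v; rewrite mem_cat in_fsetU.
rewrite big_cat /=; congr (_ * _).
  rewrite (eq_big_seq (fun=> p)) => [|v ->//].
  by rewrite big_const_seq count_predT iter_mulr_1.
rewrite (eq_big_seq (fun=> 1 - p)) => [|v /nA->//].
by rewrite big_const_seq count_predT iter_mulr_1.
Qed.

(** By [reach_subP], the event is a union, over the finitely many subsets [K] of [M], of cylinders
    that require closed sites only. *)
Lemma measurable_reach_sub (A M : {fset V}) :
  measurable [set w | reach e [set` A] (open_sites X w) `<=` [set` M]].
Proof.
have -> : [set w | reach e [set` A] (open_sites X w) `<=` [set` M]] =
    \bigcup_(K in [set` fpowerset M]) cylinder fset0 ((A `\` K) `|` bd K)%fset.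
  apply/seteqP; split=> w.
    move=> /reach_subP[K KM hK].
    have fK : finite_set K by exact: sub_finite_set KM _.
    exists (fset_set K); rewrite /= ?fpowersetE.
      by rewrite -[M]set_fsetK -fset_set_sub.
    split=> // v /=.
    rewrite in_fsetU in_fsetD in_bd fset_setK // in_fset_set // => h.
    apply: hK; move: h => /orP[/andP[/negP nK vA]|/set_mem]; [left|by right].
    by split => // vK; apply: nK; exact: mem_set.
  move=> [K /=]; rewrite fpowersetE => KM [_ hK]; apply/reach_subP.
  exists [set` K]; first exact/fsubsetP.
  move=> v h; apply: hK; rewrite /= in_fsetU in_fsetD in_bd.
  by case: h => [[-> /negP->]//|/mem_set->]; rewrite orbT.
by apply: fin_bigcup_measurable => // K _; exact: measurable_cylinder.
Qed.

(** Union bound over the candidates [K], change of weight term by term, then the Kraft inequality.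
    The finite set [M] keeps the sum finite; as the bound does not depend on it, [M] can exhaust the
    graph afterwards. *)
Lemma probability_reach_sub_le (q : R) (A B M : {fset V}) :
  let i : R := vertex_isoperimetric e in
  0 < i -> q = (i + 1)^-1 -> q < p < 1 ->
  B != fset0 -> (B `<=` A)%fset -> (bd B `<=` A)%fset -> (B `<=` M)%fset ->
  (P [set w | reach e [set` A] (open_sites X w) `<=` [set` M]] <=
    (expR (- (p / q - 1)) ^+ #|` B|)%:E)%E.
Proof.
move=> i i0 qE qp B0 BA dBA BM.
(* Candidates for the explored set: they lie between [B] and [M], and each is joined to [B] from
   inside. *)
pose r := [fset K in fpowerset M | `[<([set` B] `<=` [set` K] /\
   [set` K] `<=` reach e [set` B] [set` K])%classic>] ]%fset.
have rP K : K \in r ->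
    [/\ (B `<=` K)%fset & [set` K] `<=` reach e [set` B] [set` K]].
  by rewrite !inE /= => /andP[_ /asboolP[/fsubsetP BK rK]].
have dis K : [disjoint K `\` B & bd K]%fset.
  apply/fdisjointP => v; rewrite in_fsetD in_bd => /andP[_ vK].
  by apply/negP => /set_mem[].
have cover : [set w | reach e [set` A] (open_sites X w) `<=` [set` M]] `<=`
    \bigcup_(K in [set` r]) cylinder (K `\` B)%fset (bd K).
  move=> w /(@reach_setU_sub _ e [set` B]) h.
  have {}h : reach e [set` B] (open_sites X w `|` [set` B]) `<=` [set` M].
    apply: h; [exact/fsubsetP| |exact/fsubsetP].
    by move=> v /mem_set; rewrite -in_bd; exact/fsubsetP.
  have fK : finite_set (reach e [set` B] (open_sites X w `|` [set` B])).
    exact: sub_finite_set h _.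
  have [BK rK KO dK] := reach_setU_explored e [set` B] (open_sites X w).
  exists (fset_set (reach e [set` B] (open_sites X w `|` [set` B]))).
    rewrite /= !inE /= fpowersetE; apply/andP; split; last first.
      by rewrite fset_setK //; exact/asboolP.
    by rewrite -[M]set_fsetK -fset_set_sub.
  split=> v /=.
    rewrite in_fsetD in_fset_set // => /andP[/negP nB /set_mem vK].
    exact: KO.
  by rewrite in_bd fset_setK // => /set_mem; exact: dK.
apply: (le_trans (content_sub_fsum P _ _ _ cover)) => //.
- by move=> K _; exact: measurable_cylinder.
- exact: measurable_reach_sub.
rewrite fsbig_finite //= set_fsetK.
rewrite (eq_bigr _ (fun K _ => probability_cylinder (dis K))) sumEFin lee_fin.
have q01 : 0 <= q <= 1.
  rewrite qE invr_ge0 invf_le1; lra.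
apply: (@le_trans _ _ (\sum_(K <- r) expR (- (p / q - 1)) ^+ #|` B| *
    (q ^+ #|` K `\` B|%fset * (1 - q) ^+ #|` bd K|))).
  rewrite big_seq [leRHS]big_seq; apply: ler_sum => K /rP[BK _].
  apply: (bernoulli_weight_tilt i0) => //.
  (* As [|K \ B| + |B| = |K|], the condition on the exponents is the isoperimetric inequality for
     [K], which is nonempty since it contains [B]. *)
  rewrite cardfsD (fsetIidPr BK) subnK ?fsubset_leq_card //.
  apply: isoperimetric_le; apply: contra_neq B0 => K0.
  by move: BK; rewrite K0 fsubset0 => /eqP.
rewrite -mulr_sumr -[leRHS]mulr1 ler_wpM2l ?exprn_ge0 ?expR_ge0 //.
apply: kraft_fset => // K K' /rP[BK rK] /rP[BK' rK'].
(* Without a site required open by one candidate and closed by the other, each of [K] and [K']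
   contains the other. *)
apply: contra_neqP => no; apply/eqP; rewrite eqEfsubset.
have inc := @explored_incompatible _ e [set` B].
apply/andP; split; apply/fsubsetP; apply: inc => //; try exact/fsubsetP.
  move=> v [[vK /negP vB] /mem_set dv]; apply: no; exists v.
  by rewrite in_fsetD vB [v \in K]vK in_bd dv.
move=> v [[vK /negP vB] /mem_set dv]; apply: no; exists v.
by rewrite !in_fsetD vB [v \in K']vK !in_bd dv orbT.
Qed.

End Events.

(** * Bound uniform in the centre, and passage to the limit *)

Theorem theorem1p4 (R : realType) (V : choiceType) (e : rel V) (p : R)
    (d : measure_display) (Omega : measurableType d)
    (P : probability Omega R) (X : V -> {RV P >-> bool}) :
  symmetric e -> irreflexive e ->
  connected_graph e -> locally_finite e ->
  0 < vertex_isoperimetric e :> R ->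
  1 / (vertex_isoperimetric e + 1) < p < 1 ->
  bernoulli_site_percolation p X ->
  uniform_percolation e X.
Proof.
move=> sym _ con lf i0 pi bern.
set i : R := vertex_isoperimetric e in i0 pi.
pose q := (i + 1)^-1; have q0 : 0 < q by rewrite invr_gt0; lra.
have qp : q < p < 1 by move: pi; rewrite div1r.
pose z := expR (- (p / q - 1)).
have z1 : 0 < z < 1.
  rewrite expR_gt0 /= -expR0 ltr_expR oppr_lt0 subr_gt0 ltr_pdivlMr // mul1r.
  by case/andP: qp.
have bound x N :
    ((1 - z ^+ N)%:E <= P (ball_meets_infinite_cluster e X x N.+1) <= 1)%E.
  pose ball n := fset_set (graph_ball e x n).
  have fball := finite_graph_ball con lf x.
  have ballE n : [set` ball n] = graph_ball e x n by rewrite fset_setK.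
  (* The truncated events [L m] increase to the event that no infinite cluster meets the ball of
     radius [N + 1]. *)
  pose L m := [set w |
    reach e [set` ball N.+1] (open_sites X w) `<=` [set` ball m]].
  have mL m : measurable (L m) by exact: measurable_reach_sub.
  have HE : ball_meets_infinite_cluster e X x N.+1 = ~` \bigcup_m L m.
    apply/seteqP; split=> w.
      move=> /(infinite_reachP _ sym (fball N.+1)) ir [m _].
      rewrite /L /= !ballE => rm; apply: ir.
      apply/(finite_setP_graph_ball con lf x).
      by exists m.
    move=> nL; apply/(infinite_reachP _ sym (fball N.+1)).
    move=> /(finite_setP_graph_ball con lf x)[m rm]; apply: nL; exists m => //.
    by rewrite /L /= !ballE.
  have mU : measurable (\bigcup_m L m) by exact: bigcupT_measurable.
  rewrite HE; apply/andP; split; last exact/probability_le1/measurableC.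
  rewrite probability_setC // EFinB leeB //.
  have cv : (P \o L) m @[m --> \oo] --> P (\bigcup_m L m).
    apply: nondecreasing_cvg_mu => // m n mn; apply/subsetPset => w.
    by rewrite /L /= !ballE => /subset_trans; apply; exact: sub_graph_ball.
  rewrite -(cvg_lim _ cv) //; apply: lime_le.
    by apply/cvg_ex; eexists; exact: cv.
  (* The estimate asks that the ball of radius [m] contain the ball of radius [N], so it is applied
     from [m = N] on. *)
  exists N => // m /= Nm.
  have cB := ltn_card_graph_ball con lf x N i0.
  (* Since [z <= 1], the ball size can be replaced by its lower bound [N], which is the same for all
     [x]. *)
  apply: (@le_trans _ _ (z ^+ #|` ball N|)%:E); last first.
    case/andP: z1 => *; rewrite lee_fin.
    by apply: ler_wiXn2l; [exact: ltW|exact: ltW|exact: ltnW].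
  have p01 : 0 <= p <= 1 by case/andP: qp => *; apply/andP; lra.
  have sb n : (N <= n)%N -> (ball N `<=` ball n)%fset.
    by move=> Nn; rewrite -fset_set_sub //; exact: sub_graph_ball.
  apply: (probability_reach_sub_le lf p01 bern i0 (erefl q) qp).
  - by rewrite -cardfs_gt0; exact: leq_ltn_trans cB.
  - exact: sb.
  - rewrite ballE -fset_set_sub //; last exact: finite_vertex_boundary.
    by rewrite (graph_ballS con) => v; right.
  - exact: sb.
(* The bound concerns radius [N + 1], hence the shift of the sequence by one. *)
rewrite /uniform_percolation -(cvg_shiftS _).
have cvz : (1 - z ^+ N)%:E @[N --> \oo] --> 1%E.
  apply: cvg_EFin; first exact: nearW.
  rewrite -[X in _ --> X]subr0; apply: cvgB; first exact: cvg_cst.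
  by apply: cvg_expr; rewrite gtr0_norm; case/andP: z1.
apply: (squeeze_cvge _ cvz (cvg_cst 1%E)); apply: nearW => N; apply/andP; split.
  by apply/ereal_infP => _ [x _ <-]; have /andP[] := bound x N.
(* A single vertex keeps the infimum below 1; it exists because a connected graph is nonempty, while
   an infimum over the empty set would be infinite. *)
have [[x _] _] := con; apply: ge_ereal_inf.
exists (P (ball_meets_infinite_cluster e X x N.+1)); first by exists x.
by have /andP[] := bound x N.
Qed.
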